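(* For all integers $n\ge 0$ and $k,m\ge 1$, $$\mathbf F_n(k,m)=\sum_{j=0}^{n}\binom nj\, i^{\,j}\,S_{n-j}(k)\,S_j(m).$$
   Context: Here $i^2=-1$. For integers $n\ge 0$ and $k,m\ge 1$, $\mathbf F_n(k,m)=\sum_{a=1}^{k}\sum_{b=1}^{m}(a+bi)^n\in\mathbb Z[i]$. For integers $r\ge 0$ and $N\ge 1$, $S_r(N)=\sum_{t=1}^{N}t^r\in\mathbb Z$. *)

(* Defs.v *)
(* MathComp world. *)
From HB Require Import structures.
From mathcomp Require Import all_boot all_order all_algebra all_field.

Set Implicit Arguments.
Unset Strict Implicit.
Unset Printing Implicit Defensive.

Import Order.TTheory GRing.Theory Num.Theory.
Local Open Scope ring_scope.

(* Z[i] is the subring of the complex algebraic numbers with integral real and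
   imaginary parts. *)
Definition gaussInteger : {pred algC} :=
  [pred x | ('Re x \in Num.int) && ('Im x \in Num.int)].

Lemma gaussInteger_subring_closed : subring_closed gaussInteger.
Proof.
split=> [|x y /andP[xR xI] /andP[yR yI]|x y /andP[xR xI] /andP[yR yI]].
- rewrite inE (Creal_ReP _ _) ?(Creal_ImP _ _) ?rpred1 //=.
- by rewrite inE !raddfB /= !rpredB.
- by rewrite inE ReM ImM rpredB ?rpredD //= rpredM.
Qed.

HB.instance Definition _ :=
  GRing.isSubringClosed.Build algC gaussInteger gaussInteger_subring_closed.

Record gaussInt := GaussInt { gval : algC; gvalP : gval \in gaussInteger }.

HB.instance Definition _ := [isSub for gval].
HB.instance Definition _ := [Choice of gaussInt by <:].
HB.instance Definition _ := [SubChoice_isSubComNzRing of gaussInt by <:].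

Lemma i_gaussInteger : 'i \in gaussInteger.
Proof. by rewrite inE Re_i Im_i rpred0 rpred1. Qed.

Definition gaussI : gaussInt := GaussInt i_gaussInteger.

Lemma gaussI_sqr : gaussI ^+ 2 = -1.
Proof. by apply: val_inj; rewrite rmorphXn rmorphN1 /= sqrCi. Qed.

Definition gaussPowSum (n k m : nat) : gaussInt :=
  \sum_(1 <= a < k.+1) \sum_(1 <= b < m.+1) (a%:R + b%:R * gaussI) ^+ n.

Definition powSum (r N : nat) : int := \sum_(1 <= t < N.+1) t%:Z ^+ r.

(* Main.v *)
Require Import Defs.
From mathcomp Require Import all_boot all_order all_algebra all_field.

Import GRing.Theory.
Local Open Scope ring_scope.

(** Expand each summand [(a + b i) ^+ n] by the binomial theorem and move the
    sum over the exponent [j] outermost. For fixed [j] the term is a product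
    of a constant, a function of [a] and a function of [b], so the double sum
    over the rectangle factors into the two power sums. *)

Lemma intr_powSum (R : nzRingType) (r N : nat) :
  (powSum r N)%:~R = \sum_(1 <= t < N.+1) t%:R ^+ r :> R.
Proof. by rewrite rmorph_sum; apply: eq_bigr => t _; rewrite rmorphXn. Qed.

Theorem lemma1 (n k m : nat) (hk : (1 <= k)%N) (hm : (1 <= m)%N) :
  gaussPowSum n k m =
  \sum_(0 <= j < n.+1)
    'C(n, j)%:R * gaussI ^+ j * (powSum (n - j) k)%:~R * (powSum j m)%:~R.
Proof.
rewrite /gaussPowSum.
under eq_bigr => a _.
  under eq_bigr => b _ do rewrite exprDn -(big_mkord xpredT
    (fun j => (a%:R ^+ (n - j) * (b%:R * gaussI) ^+ j) *+ 'C(n, j))).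
  rewrite exchange_big; over.
rewrite exchange_big; apply: eq_bigr => j _.
rewrite !intr_powSum -mulrA big_distrlr mulr_sumr; apply: eq_bigr => a _.
rewrite mulr_sumr; apply: eq_bigr => b _ /=.
by rewrite exprMn -[LHS]mulr_natl -mulrA [_ ^+ j * gaussI ^+ j]mulrC
  (mulrCA (a%:R ^+ _)).
Qed.
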